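(* Suppose $\widetilde U=(\widetilde U_1,\widetilde U_2)$ and $\widehat U=(\widehat U_1,\widehat U_2)$ are ordered upper and lower solutions (nondecreasing case) of the scheme (NDS), and suppose that for every $m\ge1$, every $p\in\overline\Omega^h$, every $\alpha\neq\alpha'$ in $\{1,2\}$ and every $u\in\mathbb R^2$ with $\widehat U(p,t_m)\le u\le\widetilde U(p,t_m)$, $$\frac{\partial f_\alpha(p,t_m,u)}{\partial u_\alpha}\le c_\alpha(p,t_m),\qquad -\frac{\partial f_\alpha(p,t_m,u)}{\partial u_{\alpha'}}\ge0,$$ where $c_\alpha$ are nonnegative bounded functions. Let $\{(\overline U^{(n)}_{\alpha,i,m})_J,(\underline U^{(n)}_{\alpha,i,m})_J\}$ and $\{(\overline U^{(n)}_{\alpha,i,m})_{GS},(\underline U^{(n)}_{\alpha,i,m})_{GS}\}$ be the upper and lower sequences generated, respectively, by the block Jacobi method ($\eta=0$) and by the block Gauss--Seidel method ($\eta=1$), with $(\overline U^{(0)})_J=(\overline U^{(0)})_{GS}=\widetilde U$ and $(\underline U^{(0)})_J=(\underline U^{(0)})_{GS}=\widehat U$. Then, for all $n$, $$(\underline U^{(n)}_{\alpha,i,m})_J\le(\underline U^{(n)}_{\alpha,i,m})_{GS}\le(\overline U^{(n)}_{\alpha,i,m})_{GS}\le(\overline U^{(n)}_{\alpha,i,m})_J,\qquad i=0,1,\dots,N_x,\ \alpha=1,2,\ m\ge1.$$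
   Context: Data: $l_1,l_2,T>0$, $\omega=(0,l_1)\times(0,l_2)$, $Q_T=\omega\times(0,T]$, $\partial Q_T=\partial\omega\times(0,T]$; for $\alpha=1,2$: constants $\varepsilon_\alpha>0$, smooth functions $f_\alpha(x,y,t,u)$, $u=(u_1,u_2)$, $g_\alpha$ on $\partial Q_T$, $\psi_\alpha$ on $\overline\omega$, and smooth nonnegative $v_{\alpha,1},v_{\alpha,2}$ on $\overline Q_T$. Vector inequalities are componentwise; $\alpha'$ denotes the index in $\{1,2\}$ different from $\alpha$. Mesh: $x_i=ih_x$ ($0\le i\le N_x$, $h_x=l_1/N_x$), $y_j=jh_y$ ($0\le j\le N_y$, $h_y=l_2/N_y$), $t_m=m\tau$ ($0\le m\le N_\tau$, $\tau=T/N_\tau$). $\overline\Omega^h$ is the set of all $p=(x_i,y_j)$, $\Omega^h$ the interior ones, $\partial\Omega^h=\overline\Omega^h\setminus\Omega^h$. ''$m\ge1$'' means $1\le m\le N_\tau$. Write $U_{\alpha,ij,m}=U_\alpha(x_i,y_j,t_m)$. Operator: $\mathcal L^h_\alpha U_\alpha=-\varepsilon_\alpha(D_x^2U_\alpha+D_y^2U_\alpha)+v_{\alpha,1}D_x^1U_\alpha+v_{\alpha,2}D_y^1U_\alpha$, with $D_x^2,D_y^2$ the standard second central differences and $D_x^1,D_y^1$ the backward differences, e.g. $D^1_xU_{\alpha,ij,m}=(U_{\alpha,ij,m}-U_{\alpha,i-1,j,m})/h_x$. Scheme (NDS): for $\alpha=1,2$, $m\ge1$, $(\mathcal L^h_\alpha(p,t_m)+\tau^{-1})U_\alpha(p,t_m)+f_\alpha(p,t_m,U)-\tau^{-1}U_\alpha(p,t_{m-1})=0$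 for $p\in\Omega^h$; $U(p,t_m)=g(p,t_m)$ for $p\in\partial\Omega^h$; $U(p,0)=\psi(p)$ for $p\in\overline\Omega^h$. Ordered upper and lower solutions (nondecreasing case): $\widetilde U,\widehat U$ are such if, for all $m\ge1$ and $\alpha=1,2$: $\widetilde U\ge\widehat U$ on $\overline\Omega^h$; on $\Omega^h$, $(\mathcal L^h_\alpha+\tau^{-1})\widetilde U_\alpha(p,t_m)+f_\alpha(p,t_m,\widetilde U)-\tau^{-1}\widetilde U_\alpha(p,t_{m-1})\ge0$ and $(\mathcal L^h_\alpha+\tau^{-1})\widehat U_\alpha(p,t_m)+f_\alpha(p,t_m,\widehat U)-\tau^{-1}\widehat U_\alpha(p,t_{m-1})\le0$; $\widehat U\le g\le\widetilde U$ on $\partial\Omega^h$; and $\widehat U(p,0)\le\psi(p)\le\widetilde U(p,0)$ on $\overline\Omega^h$. Block form: $l_{\alpha,ij,m}=\varepsilon_\alpha h_x^{-2}+v_{\alpha,1}(x_i,y_j,t_m)h_x^{-1}$, $r_{\alpha,ij,m}=\varepsilon_\alpha h_x^{-2}$, $b_{\alpha,ij,m}=\varepsilon_\alpha h_y^{-2}+v_{\alpha,2}(x_i,y_j,t_m)h_y^{-1}$, $t_{\alpha,ij,m}=\varepsilon_\alpha h_y^{-2}$, $d_{\alpha,ij,m}=\tau^{-1}+l_{\alpha,ij,m}+r_{\alpha,ij,m}+b_{\alpha,ij,m}+t_{\alpha,ij,m}$. Put $U_{\alpha,i,m}=(U_{\alpha,i,1,m},\dots,U_{\alpha,i,N_y-1,m})^T$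 for $0\le i\le N_x$, and define $g_{\alpha,i,m}$ ($i=0,N_x$), $\psi_{\alpha,i}$ likewise. $L_{\alpha,i,m},R_{\alpha,i,m}$ are the diagonal matrices with entries $l_{\alpha,ij,m}$, $r_{\alpha,ij,m}$, $1\le j\le N_y-1$; $A_{\alpha,i,m}$ is the tridiagonal matrix with diagonal entries $d_{\alpha,ij,m}$, subdiagonal entries $-b_{\alpha,ij,m}$ and superdiagonal entries $-t_{\alpha,ij,m}$ in row $j$; $F_{\alpha,i,m}(U_{1,i,m},U_{2,i,m})$ is the vector with entries $f_\alpha(x_i,y_j,t_m,U_{1,ij,m},U_{2,ij,m})$; $G^*_{\alpha,i,m}$ is the vector collecting the contributions of the boundary values at $j=0,N_y$: it has $-b_{\alpha,i1,m}g_\alpha(x_i,y_0,t_m)$ added in its first entry, $-t_{\alpha,i,N_y-1,m}g_\alpha(x_i,y_{N_y},t_m)$ added in its last entry, and is zero otherwise. For $1\le i\le N_x-1$ the residual is $$\mathcal G_{\alpha,i,m}(U_{\alpha,i,m},U_{\alpha,i,m-1},U_{\alpha',i,m})=A_{\alpha,i,m}U_{\alpha,i,m}-L_{\alpha,i,m}U_{\alpha,i-1,m}-R_{\alpha,i,m}U_{\alpha,i+1,m}+F_{\alpha,i,m}(U_{1,i,m},U_{2,i,m})-\tau^{-1}U_{\alpha,i,m-1}+G^*_{\alpha,i,m}.$$ Block iterative method with parameter $\eta\in\{0,1\}$: $c_{\alpha,m}=\max_{p\in\overline\Omega^h}c_\alpha(p,t_m)$. On each level $m\ge1$, starting from $U^{(0)}$,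 define $U^{(n)}=U^{(n-1)}+Z^{(n)}$, $n\ge1$, where for $1\le i\le N_x-1$, $\alpha=1,2$, $$A_{\alpha,i,m}Z^{(n)}_{\alpha,i,m}-\eta L_{\alpha,i,m}Z^{(n)}_{\alpha,i-1,m}+c_{\alpha,m}Z^{(n)}_{\alpha,i,m}=-\mathcal G_{\alpha,i,m}\big(U^{(n-1)}_{\alpha,i,m},U_{\alpha,i,m-1},U^{(n-1)}_{\alpha',i,m}\big),$$ and for $i=0,N_x$: $Z^{(1)}_{\alpha,i,m}=g_{\alpha,i,m}-U^{(0)}_{\alpha,i,m}$, $Z^{(n)}_{\alpha,i,m}=0$ for $n\ge2$. Here $U_{\alpha,i,0}=\psi_{\alpha,i}$ and, for $m\ge1$, $U_{\alpha,i,m}=U^{(n_m)}_{\alpha,i,m}$ is the approximate solution on level $m$, $n_m\ge1$ being the number of iterations performed on level $m$; the numbers $n_m$ are the same for the Jacobi and the Gauss--Seidel sequences. The upper sequence $\overline U^{(n)}$ (with approximate solutions $\overline U_{\alpha,i,m}$) uses $\overline U^{(0)}$ and the lower sequence $\underline U^{(n)}$ (with $\underline U_{\alpha,i,m}$) uses $\underline U^{(0)}$. *)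

(* Defs.v *)
From HB Require Import structures.
From mathcomp Require Import all_boot all_order all_algebra.
From mathcomp Require Import all_classical all_reals all_analysis.

Set Implicit Arguments.
Unset Strict Implicit.
Unset Printing Implicit Defensive.

Import Order.TTheory GRing.Theory Num.Theory.
Import numFieldNormedType.Exports.

Local Open Scope classical_set_scope.
Local Open Scope ring_scope.

(* Used only for finite-dimensional V, where, for O open, this is the usual
   class C^k on O. *)
Fixpoint Ck_on (R : realType) (V : normedModType R) (k : nat) (O : set V)
    (f : V -> R) : Prop :=
  match k with
  | 0 => forall x, O x -> {for x, continuous f}
  | k'.+1 => (forall x, O x -> differentiable f x) /\
             (forall v : V, Ck_on k' O ('D_v f))
  end.

(* Smoothness on a set that need not be open: there is a C^oo extension to
   some open neighbourhood of the set. *)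
Definition smooth_on (R : realType) (V : normedModType R) (A : set V)
    (f : V -> R) : Prop :=
  exists (O : set V) (F : V -> R),
    [/\ open O, A `<=` O, forall k, Ck_on k O F & {in A, F =1 f}].

(* Componentwise order on vectors and matrices. *)
Definition mxle (R : realType) (m n : nat) (A B : 'M[R]_(m, n)) : Prop :=
  forall i j, A i j <= B i j.

(* Points of space-time are triples (x, y, t); the component index alpha
   ranges over 'I_2, and u = (u_1, u_2) is a row vector. *)
Record problem (R : realType) := Problem {
  l1 : R;
  l2 : R;
  tend : R;
  eps : 'I_2 -> R;
  v1 : 'I_2 -> R * R * R -> R;
  v2 : 'I_2 -> R * R * R -> R;
  f : 'I_2 -> R * R * R * 'rV[R]_2 -> R;
  g : 'I_2 -> R * R * R -> R;
  psi : 'I_2 -> R * R -> R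
}.

Section Domain.
Variables (R : realType) (P : problem R).

Definition omega : set (R * R) := `]0, l1 P[ `*` `]0, l2 P[.
Definition omega_bar : set (R * R) := `[0, l1 P] `*` `[0, l2 P].
Definition QT_bar : set (R * R * R) := omega_bar `*` `[0, tend P].
Definition bdry_QT : set (R * R * R) :=
  (omega_bar `\` omega) `*` `]0, tend P].

Record standing_assumptions : Prop := StandingAssumptions {
  l1_gt0 : 0 < l1 P;
  l2_gt0 : 0 < l2 P;
  tend_gt0 : 0 < tend P;
  eps_gt0 : forall a, 0 < eps P a;
  f_smooth : forall a, smooth_on (QT_bar `*` setT) (f P a);
  g_smooth : forall a, smooth_on bdry_QT (g P a);
  psi_smooth : forall a, smooth_on omega_bar (psi P a);
  v1_smooth : forall a, smooth_on QT_bar (v1 P a);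
  v2_smooth : forall a, smooth_on QT_bar (v2 P a);
  v1_ge0 : forall a p, QT_bar p -> 0 <= v1 P a p;
  v2_ge0 : forall a p, QT_bar p -> 0 <= v2 P a p
}.

End Domain.

Record mesh := Mesh {
  Nx : nat;
  Ny : nat;
  Nt : nat;
  Nx_gt0 : (0 < Nx)%N;
  Ny_gt0 : (0 < Ny)%N;
  Nt_gt0 : (0 < Nt)%N
}.

(* U a i j m stands for U_a(x_i, y_j, t_m); only the values with i <= Nx,
   j <= Ny, m <= Nt are meaningful. *)
Definition meshfun (R : realType) := 'I_2 -> nat -> nat -> nat -> R.

Section Scheme.
Variables (R : realType) (P : problem R) (M : mesh).

Definition hx : R := l1 P / (Nx M)%:R.
Definition hy : R := l2 P / (Ny M)%:R.
Definition tau : R := tend P / (Nt M)%:R.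

Definition node2 (i j : nat) : R * R := (i%:R * hx, j%:R * hy).
Definition node (i j m : nat) : R * R * R := (node2 i j, m%:R * tau).

Definition in_mesh (i j : nat) : bool := (i <= Nx M)%N && (j <= Ny M)%N.
Definition interior_node (i j : nat) : bool :=
  (0 < i < Nx M)%N && (0 < j < Ny M)%N.
Definition boundary_node (i j : nat) : bool :=
  in_mesh i j && ~~ interior_node i j.
Definition level (m : nat) : bool := (1 <= m <= Nt M)%N.

Definition vals (U : meshfun R) (i j m : nat) : 'rV[R]_2 :=
  \row_(a < 2) U a i j m.

Definition D2x (U : meshfun R) a i j m : R :=
  (U a i.+1 j m - 2%:R * U a i j m + U a i.-1 j m) / hx ^+ 2.
Definition D2y (U : meshfun R) a i j m : R :=
  (U a i j.+1 m - 2%:R * U a i j m + U a i j.-1 m) / hy ^+ 2.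
Definition D1x (U : meshfun R) a i j m : R := (U a i j m - U a i.-1 j m) / hx.
Definition D1y (U : meshfun R) a i j m : R := (U a i j m - U a i j.-1 m) / hy.

Definition Lh (U : meshfun R) a i j m : R :=
  - eps P a * (D2x U a i j m + D2y U a i j m)
  + v1 P a (node i j m) * D1x U a i j m
  + v2 P a (node i j m) * D1y U a i j m.

(* Left-hand side of the nonlinear difference scheme at an interior node. *)
Definition nds (U : meshfun R) a i j m : R :=
  Lh U a i j m + tau^-1 * U a i j m
  + f P a (node i j m, vals U i j m) - tau^-1 * U a i j m.-1.

Record ordered_upper_lower (Ut Ul : meshfun R) : Prop := OrderedUpperLower {
  oul_le : forall a i j m, level m -> in_mesh i j ->
    Ul a i j m <= Ut a i j m;
  oul_upper : forall a i j m, level m -> interior_node i j ->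
    0 <= nds Ut a i j m;
  oul_lower : forall a i j m, level m -> interior_node i j ->
    nds Ul a i j m <= 0;
  oul_bdry : forall a i j m, level m -> boundary_node i j ->
    Ul a i j m <= g P a (node i j m) <= Ut a i j m;
  oul_init : forall a i j, in_mesh i j ->
    Ul a i j 0%N <= psi P a (node2 i j) <= Ut a i j 0%N
}.

Definition lcoef a i j m : R :=
  eps P a / hx ^+ 2 + v1 P a (node i j m) / hx.
Definition rcoef a (i j m : nat) : R := eps P a / hx ^+ 2.
Definition bcoef a i j m : R :=
  eps P a / hy ^+ 2 + v2 P a (node i j m) / hy.
Definition tcoef a (i j m : nat) : R := eps P a / hy ^+ 2.
Definition dcoef a i j m : R :=
  tau^-1 + lcoef a i j m + rcoef a i j m + bcoef a i j m + tcoef a i j m.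

(* Entry j : 'I_(Ny - 1) of a block belongs to the mesh line y_(j+1). *)
Definition block := 'cV[R]_((Ny M).-1).

Definition block_of (U : meshfun R) a i m : block := \col_j U a i j.+1 m.
Definition gblock a i m : block := \col_j g P a (node i j.+1 m).
Definition psiblock a i : block := \col_j psi P a (node2 i j.+1).

Definition Lmx a i m : 'M[R]_((Ny M).-1) :=
  diag_mx (\row_j lcoef a i j.+1 m).
Definition Rmx a i m : 'M[R]_((Ny M).-1) :=
  diag_mx (\row_j rcoef a i j.+1 m).
Definition Amx a i m : 'M[R]_((Ny M).-1) :=
  \matrix_(j, k)
    if k == j then dcoef a i j.+1 m
    else if k.+1 == j :> nat then - bcoef a i j.+1 m
    else if k == j.+1 :> nat then - tcoef a i j.+1 m
    else 0.

Definition Fblock a i m (W : 'I_2 -> block) : block :=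
  \col_j f P a (node i j.+1 m, \row_(b < 2) W b j 0).

(* When Ny = 2 the only entry receives both boundary contributions. *)
Definition Gstar a i m : block :=
  \col_j ((if j == 0%N :> nat
           then - bcoef a i 1 m * g P a (node i 0 m) else 0)
        + (if j.+1 == (Ny M).-1
           then - tcoef a i (Ny M).-1 m * g P a (node i (Ny M) m) else 0)).

(* W holds the blocks of the current level, Wprev the block with the same
   component a and line i on the previous level. *)
Definition residual a i m (W : 'I_2 -> nat -> block) (Wprev : block) : block :=
  Amx a i m *m W a i - Lmx a i m *m W a i.-1 - Rmx a i m *m W a i.+1
  + Fblock a i m (fun b => W b i) - tau^-1 *: Wprev + Gstar a i m.

Definition cmax (c : meshfun R) a m : R :=
  \big[Num.max/c a 0%N 0%N m]_(i < (Nx M).+1)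
    \big[Num.max/c a 0%N 0%N m]_(j < (Ny M).+1) c a i j m.

(* iterates m n a i is the n-th iterate on level m. *)
Definition iterates := nat -> nat -> 'I_2 -> nat -> block.

Definition approx (nm : nat -> nat) (U : iterates) (m : nat) a i : block :=
  if m is 0 then psiblock a i else U m (nm m) a i.

Definition increment (U : iterates) m n a i : block :=
  U m n a i - U m n.-1 a i.

(* U is the sequence generated from U0 by the block iterative method with
   parameter eta and nm m iterations on level m. *)
Record block_sequence (eta : bool) (c : meshfun R) (nm : nat -> nat)
    (U0 : meshfun R) (U : iterates) : Prop := BlockSequence {
  bs_start : forall m a i, level m -> (i <= Nx M)%N ->
    U m 0%N a i = block_of U0 a i m;
  bs_inner : forall m n a i, level m -> (1 <= n)%N -> (0 < i < Nx M)%N ->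
    Amx a i m *m increment U m n a i
    - eta%:R *: (Lmx a i m *m increment U m n a i.-1)
    + cmax c a m *: increment U m n a i
    = - residual a i m (U m n.-1) (approx nm U m.-1 a i);
  bs_bdry1 : forall m a i, level m -> i = 0%N \/ i = Nx M ->
    increment U m 1 a i = gblock a i m - U m 0%N a i;
  bs_bdry : forall m n a i, level m -> (2 <= n)%N -> i = 0%N \/ i = Nx M ->
    increment U m n a i = 0
}.

Definition block_Jacobi := block_sequence false.
Definition block_Gauss_Seidel := block_sequence true.

(* Partial derivative of f_a with respect to u_b at (p, u). *)
Definition df a b (p : R * R * R) (u : 'rV[R]_2) : R :=
  'D_(delta_mx 0 b) (fun w : 'rV[R]_2 => f P a (p, w)) u.

End Scheme.

(* Main.v *)
Require Import Defs.
From HB Require Import structures.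
From mathcomp Require Import all_boot all_order all_algebra.
From mathcomp Require Import all_classical all_reals all_analysis.
From mathcomp Require Import ring lra zify.

Set Implicit Arguments.
Unset Strict Implicit.
Unset Printing Implicit Defensive.

Import Order.TTheory GRing.Theory Num.Theory.
Import numFieldNormedType.Exports.
Local Open Scope ring_scope.

(** On one time level, write [V] for an iterate and [X] for the next one.  On
    each interior line [i] the residual equation, once the terms in [V] have been
    moved to the right, reads
      [(A_i + c) X_i = c V_i - F(V_i) + L_i Y_(i-1) + R_i V_(i+1) + W_i / tau - G*],
    where [W] is the previous time level and [Y] is the line the method has at
    hand on the left: [V] for Jacobi, the freshly computed [X] for Gauss-Seidel.
    Two facts make everything monotone.
    - The right-hand side is nondecreasing in [V], [Y] and [W] as long as [V] stays
      between the lower and the upper solution: the bounds on the partial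
      derivatives of [f] say, by the mean value theorem, that [c u_a - f_a(u)] is
      nondecreasing in both components of [u] ([reaction_increment_le]), and [L],
      [R] have nonnegative entries.
    - The left-hand side is inverse-monotone: [A_i + c] has nonpositive
      off-diagonal entries and positive row sums ([Zmatrix_ge0]).
    Hence two sweeps with ordered data produce ordered results; this is [sweep_le],
    proved by induction on the line, and it only needs one sweep to satisfy its
    equation with [<=] and the other with [>=].

    All the comparisons are instances of [sweep_le].  The upper solution satisfies
    the line equation with [>=] and the lower one with [<=], so the first iterates
    move inwards; comparing consecutive sweeps, the upper sequence keeps
    decreasing and the lower one keeps increasing, and comparing the lower with
    the upper sweep keeps them ordered, hence inside the region where the
    derivative bounds hold ([bracket_level]).
    Finally, Gauss-Seidel beats Jacobi because of what it uses for [Y]: on the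
    upper side its new line is below its own old line, which is below the old
    Jacobi line by induction, and symmetrically on the lower side.  Levels are
    chained by induction on the time level, since the final iterates of a level are
    the data [W] of the next one and both methods stop after the same number of
    iterations. *)

(** * Increments of functions along segments *)

(** Mean value theorem applied to [h] along the segment from [u] to [v]. *)
Lemma segment_increment_le (R : realType) (V : normedModType R) (h : V -> R)
    (u v : V) (K : R) :
  (forall x, differentiable h x) ->
  (forall s, s \in `[0, 1] -> 'D_(v - u) h (u + s *: (v - u)) <= K) ->
  h v - h u <= K.
Proof.
move=> dh leK; set w := v - u.
pose path (s : R) := u + s *: w.
have dpath s : is_diff s path ( *:%R^~ w).
  have -> : *:%R^~ w = 0 + *:%R^~ w :> (R -> V) by rewrite add0r.
  rewrite /path; exact: is_diffD.
have dphi (s : R) : differentiable (h \o path) s.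
  exact: differentiable_comp.
have Dphi (s : R) : is_derive s 1 (h \o path) ('D_w h (path s)).
  apply: DeriveDef; first exact/derivable1_diffP.
  rewrite deriveE// diff_comp//.
  by rewrite /= diff_val scale1r deriveE.
have [|s s01] := @MVT_segment R (h \o path) (fun s => 'D_w h (path s)) 0 1 ler01.
  by apply: continuous_subspaceT => s; exact/differentiable_continuous.
rewrite /= /path scale1r scale0r addr0 /w subr0 mulr1 subrKC => ->.
exact: leK.
Qed.

Lemma derive_rV (R : realType) (n : nat) (h : 'rV[R]_n.+1 -> R)
    (x w : 'rV[R]_n.+1) :
  differentiable h x ->
  'D_w h x = \sum_b w 0 b * 'D_(delta_mx 0 b) h x.
Proof.
move=> dh; rewrite deriveE// {1}(row_sum_delta w) linear_sum.
by apply: eq_bigr => b _; rewrite linearZ /= deriveE.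
Qed.

(** The second factor is the whole space, so the slice at [p] coincides
    everywhere with a slice of the smooth extension. *)
Lemma differentiable_smooth_slice (R : realType) (V W : normedModType R)
    (A : set V) (F : V * W -> R) (p : V) :
  smooth_on (A `*` setT)%classic F -> A p ->
  forall w, differentiable (fun w => F (p, w)) w.
Proof.
move=> [D [G [oD AD CG FG]]] Ap w.
have -> : (fun w => F (p, w)) = G \o (fun w => (p, w)).
  by apply/funext => z /=; rewrite -FG// inE.
apply: differentiable_comp; first exact: differentiable_pair.
by have [+ _] := CG 1%N; apply; apply: AD.
Qed.

(** * Inverse-monotone matrices and the entrywise order *)

(** Discrete minimum principle: at an index [k] where [x] is minimal, the
    off-diagonal terms of row [k] only get larger when [x] is replaced by the
    constant [x k], so that [rowsum k * x k] is at least [(B x) k >= 0]. *)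
Lemma Zmatrix_ge0 (R : realType) (n : nat) (B : 'M[R]_n) (x : 'cV[R]_n) :
  (forall j k, j != k -> B j k <= 0) ->
  (forall j, 0 < \sum_k B j k) ->
  mxle 0 (B *m x) -> mxle 0 x.
Proof.
move=> offdiag rowsum Bx_ge0 j z; rewrite (ord1 z) mxE {z}.
case: (@Order.TotalTheory.arg_minP _ _ _ j xpredT (fun k => x k 0) isT)
  => k _ xk_min.
apply: le_trans (xk_min j isT).
rewrite -(pmulr_lge0 _ (rowsum k)) mulr_sumr.
have := Bx_ge0 k 0; rewrite !mxE => /le_trans; apply.
apply: ler_sum => l _; have [<-|kl] := eqVneq k l; first by rewrite mulrC.
by rewrite mulrC; apply: ler_wnM2r; [exact: offdiag | exact: xk_min].
Qed.

Section MxleTheory.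
Variables (R : realType) (p q : nat).
Implicit Types A B C : 'M[R]_(p, q).

Lemma mxle_refl A : mxle A A.
Proof. by []. Qed.

Lemma mxle_trans B A C : mxle A B -> mxle B C -> mxle A C.
Proof. by move=> AB BC i j; apply: le_trans (AB i j) (BC i j). Qed.

End MxleTheory.
#[local] Hint Resolve mxle_refl : core.

(** * Signs of the difference coefficients *)

Section Mesh.
Variables (R : realType) (P : problem R) (M : mesh).
Hypothesis HP : standing_assumptions P.

Local Notation block := (block R M).
Local Notation node := (node P M).
Local Notation tau := (tau P M).
Local Notation lcoef := (lcoef P M).
Local Notation rcoef := (rcoef P M).
Local Notation bcoef := (bcoef P M).
Local Notation tcoef := (tcoef P M).
Local Notation dcoef := (dcoef P M).

Lemma hx_gt0 : 0 < hx P M.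
Proof. by rewrite divr_gt0 ?ltr0n ?Nx_gt0 ?l1_gt0. Qed.

Lemma hy_gt0 : 0 < hy P M.
Proof. by rewrite divr_gt0 ?ltr0n ?Ny_gt0 ?l2_gt0. Qed.

Lemma tau_gt0 : 0 < tau.
Proof. by rewrite divr_gt0 ?ltr0n ?Nt_gt0 ?tend_gt0. Qed.

Lemma grid_in_itv (l : R) (N i : nat) :
  0 < l -> (0 < N)%N -> (i <= N)%N -> i%:R * (l / N%:R) \in `[0, l].
Proof.
move=> l0 N0 iN; rewrite in_itv /= mulr_ge0 ?ler0n ?divr_ge0 ?ler0n ?(ltW l0)//=.
by rewrite mulrCA ger_pMr// ler_pdivrMr ?ltr0n// mul1r ler_nat.
Qed.

Lemma node_in_QT i j m : level M m -> in_mesh M i j -> QT_bar P (node i j m).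
Proof.
move=> /andP[_ mN] /andP[iN jN].
by do !split => /=; apply: grid_in_itv;
  rewrite ?Nx_gt0 ?Ny_gt0 ?Nt_gt0 ?l1_gt0 ?l2_gt0 ?tend_gt0.
Qed.

Section Coefficients.
Variables (a : 'I_2) (i j m : nat).
Hypotheses (mL : level M m) (ij : in_mesh M i j).

Lemma lcoef_ge0 : 0 <= lcoef a i j m.
Proof.
apply: addr_ge0; apply: divr_ge0; rewrite ?exprn_ge0 ?(ltW hx_gt0)//.
  exact/ltW/eps_gt0.
by apply: v1_ge0 => //; exact: node_in_QT.
Qed.

Lemma bcoef_ge0 : 0 <= bcoef a i j m.
Proof.
apply: addr_ge0; apply: divr_ge0; rewrite ?exprn_ge0 ?(ltW hy_gt0)//.
  exact/ltW/eps_gt0.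
by apply: v2_ge0 => //; exact: node_in_QT.
Qed.

Lemma rcoef_ge0 : 0 <= rcoef a i j m.
Proof. by rewrite divr_ge0 ?exprn_ge0 ?(ltW hx_gt0) ?(ltW (eps_gt0 HP a)). Qed.

Lemma tcoef_ge0 : 0 <= tcoef a i j m.
Proof. by rewrite divr_ge0 ?exprn_ge0 ?(ltW hy_gt0) ?(ltW (eps_gt0 HP a)). Qed.

End Coefficients.

Lemma interior_line_node i (j : 'I_(Ny M).-1) :
  (0 < i < Nx M)%N -> interior_node M i j.+1.
Proof. by rewrite /interior_node => ->; have := ltn_ord j; lia. Qed.

Lemma line_in_mesh i (j : 'I_(Ny M).-1) : (i <= Nx M)%N -> in_mesh M i j.+1.
Proof. by rewrite /in_mesh => ->; have := ltn_ord j; lia. Qed.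

(** * The scheme on a mesh line *)

(** The tridiagonal product in difference form; the values at [j = 0] and
    [j = Ny] are not unknowns of the block and are dropped here. *)
Lemma mulAmx_col a i m (G : nat -> R) (j : 'I_(Ny M).-1) :
  (Amx P M a i m *m \col_k G k.+1) j 0 =
  dcoef a i j.+1 m * G j.+1
  - bcoef a i j.+1 m * (if j == 0%N :> nat then 0 else G j)
  - tcoef a i j.+1 m * (if j.+1 == (Ny M).-1 then 0 else G j.+2).
Proof.
rewrite mxE.
(* The block entries singled out by a condition on the column index. *)
pose sel (e : pred nat) := \sum_(k < (Ny M).-1) (if e k then G k.+1 else 0).
have selE n : sel (pred1 n) = if (n < (Ny M).-1)%N then G n.+1 else 0.
  rewrite /sel -big_mkcond /=; case: ltnP => nN.
    by rewrite (big_pred1 (Ordinal nN)).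
  by rewrite big_pred0// => k; apply/eqP; have := ltn_ord k; lia.
transitivity (dcoef a i j.+1 m * sel (pred1 (j : nat))
  - bcoef a i j.+1 m * sel (fun k => k.+1 == j)
  - tcoef a i j.+1 m * sel (pred1 j.+1)).
  rewrite /sel !mulr_sumr -!sumrB; apply: eq_bigr => k _; rewrite !mxE /=.
  have -> : (k == j) = (k == j :> nat) by [].
  have [->|_] := eqVneq (k : nat) j.
    have -> : (j.+1 == j :> nat) = false by lia.
    have -> : (j == j.+1 :> nat) = false by lia.
    by ring.
  have [kj|_] := eqVneq k.+1 (j : nat).
    have -> : (k == j.+1 :> nat) = false by lia.
    by ring.
  by case: ifP => _; ring.
congr (_ * _ - _ * _ - _ * _).
- by rewrite selE ltn_ord.
- case: (j : nat) (ltn_ord j) => [|j'] jN /=.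
    by rewrite /sel big1.
  transitivity (sel (pred1 j')); first by apply: eq_bigr => k _ /=; rewrite eqSS.
  by rewrite selE (ltn_trans _ jN).
- by rewrite selE ltn_neqAle ltn_ord andbT; case: eqP.
Qed.

Lemma Amx_offdiag_le0 a i m (j k : 'I_(Ny M).-1) :
  level M m -> (i <= Nx M)%N -> j != k -> Amx P M a i m j k <= 0.
Proof.
move=> mL iN; rewrite eq_sym mxE => /negPf ->.
have ij := line_in_mesh j iN.
by case: ifP => _; [|case: ifP => // _];
  rewrite oppr_le0 ?bcoef_ge0 ?tcoef_ge0.
Qed.

(** The diagonal entry exceeds [b + t] by [1 / tau + l + r]; the row sum is the
    row of the product with the constant vector 1. *)
Lemma Amx_rowsum_gt0 a i m (j : 'I_(Ny M).-1) :
  level M m -> (i <= Nx M)%N -> 0 < \sum_k Amx P M a i m j k.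
Proof.
move=> mL iN; have ij := line_in_mesh j iN.
have -> : \sum_k Amx P M a i m j k = (Amx P M a i m *m \col_k 1) j 0.
  by rewrite [RHS]mxE; apply: eq_bigr => k _; rewrite [_ k 0]mxE mulr1.
rewrite (mulAmx_col a i m (fun=> 1)) /dcoef.
have := tau_gt0; rewrite -invr_gt0.
have := lcoef_ge0 a mL ij; have := bcoef_ge0 a mL ij.
have := rcoef_ge0 a i j.+1 m; have := tcoef_ge0 a i j.+1 m.
by do 2 case: ifP => _; lra.
Qed.

Lemma ndsE (U : meshfun R) a i j m :
  nds P M U a i j m =
  dcoef a i j m * U a i j m
  - lcoef a i j m * U a i.-1 j m - rcoef a i j m * U a i.+1 j m
  - bcoef a i j m * U a i j.-1 m - tcoef a i j m * U a i j.+1 m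
  + f P a (node i j m, vals U i j m) - tau^-1 * U a i j m.-1.
Proof.
rewrite /nds /Lh /D2x /D2y /D1x /D1y /dcoef /lcoef /rcoef /bcoef /tcoef.
have := hx_gt0; have := hy_gt0; have := tau_gt0.
move: (Defs.hx P M) (Defs.hy P M) (Defs.tau P M) => hx hy t.
move=> /lt0r_neq0 t0 /lt0r_neq0 hy0 /lt0r_neq0 hx0.
by field; rewrite hx0 hy0 t0.
Qed.

Variable c : meshfun R.

(** The two sides of one block step on line [i], written for the new iterate
    instead of the increment; [Y] is the line [i.-1] on which [L] acts and [W] the
    line [i] of the previous time level. *)
Definition line_lhs a i m (X : block) : block :=
  Amx P M a i m *m X + cmax M c a m *: X.

Definition line_rhs a i m (V : 'I_2 -> nat -> block) (Y W : block) : block :=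
  cmax M c a m *: V a i + Lmx P M a i m *m Y + Rmx P M a i m *m V a i.+1
  - Fblock P a i m (fun b => V b i) + tau^-1 *: W - Gstar P M a i m.

(** The left-neighbour line used by the sweep from iterate [n] to iterate
    [n.+1]: already updated for Gauss-Seidel, not yet for Jacobi. *)
Definition swept (eta : bool) (U : iterates R M) m n a i : block :=
  if eta then U m n.+1 a i else U m n a i.

(** The residual cancels the contributions of [A], and for Gauss-Seidel also of
    [L], to the old iterate in the increment. *)
Lemma block_sequence_step eta nm U0 U m n a i :
  block_sequence P eta c nm U0 U -> level M m -> (0 < i < Nx M)%N ->
  line_lhs a i m (U m n.+1 a i)
  = line_rhs a i m (U m n) (swept eta U m n a i.-1) (Defs.approx P nm U m.-1 a i).
Proof.
move=> US mL iN; have := bs_inner US a mL (ltn0Sn n) iN.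
rewrite /increment /residual /line_lhs /line_rhs /swept /=.
move: (Gstar _ _ _ _ _) (Fblock _ _ _ _ _) (Defs.approx _ _ _ _ _ _) => G F W.
by case: eta {US}; rewrite ?scale1r ?scale0r !mulmxBr !scalerBr => E;
  apply/matrixP => j k; move/matrixP/(_ j k): E; rewrite !mxE => E; lra.
Qed.

Lemma block_sequence_bdry eta nm U0 U m n a i :
  block_sequence P eta c nm U0 U -> level M m -> i = 0%N \/ i = Nx M ->
  U m n.+1 a i = gblock P M a i m.
Proof.
move=> US mL iB; elim: n => [|n IHn].
  by have /(subIr _) := bs_bdry1 US a mL iB.
by have /subr0_eq -> := @bs_bdry _ _ _ _ _ _ _ _ US m n.+2 a i mL isT iB.
Qed.

Lemma line_lhs_colE a i m (G : nat -> R) (j : 'I_(Ny M).-1) :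
  line_lhs a i m (\col_k G k.+1) j 0 =
  dcoef a i j.+1 m * G j.+1
  - bcoef a i j.+1 m * (if j == 0%N :> nat then 0 else G j)
  - tcoef a i j.+1 m * (if j.+1 == (Ny M).-1 then 0 else G j.+2)
  + cmax M c a m * G j.+1.
Proof. by rewrite -mulAmx_col /line_lhs [LHS]mxE; congr (_ + _); rewrite !mxE. Qed.

(** The defect of a mesh function in the line equation is its defect in the
    scheme, up to terms comparing its values with the data that the block form
    uses instead: the previous level [W] and, at [j = 0] and [j = Ny], the
    boundary values [g]. *)
Lemma line_defectE (U : meshfun R) a i m (W : block) j :
  line_lhs a i m (block_of M U a i m) j 0
  - line_rhs a i m (fun b k => block_of M U b k m) (block_of M U a i.-1 m) W j 0
  = nds P M U a i j.+1 m
  + tau^-1 * (U a i j.+1 m.-1 - W j 0)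
  + (if j == 0%N :> nat
     then bcoef a i j.+1 m * (U a i 0%N m - g P a (node i 0%N m)) else 0)
  + (if j.+1 == (Ny M).-1
     then tcoef a i j.+1 m * (U a i (Ny M) m - g P a (node i (Ny M) m)) else 0).
Proof.
rewrite ndsE /line_rhs /Lmx /Rmx !mul_diag_mx.
have -> : block_of M U a i m = \col_k (U a i ^~ m) k.+1 by [].
rewrite (line_lhs_colE a i m (U a i ^~ m)) !mxE.
have -> : (\row_b (block_of M U b i m) j 0) = vals U i j.+1 m.
  by apply/matrixP => k b; rewrite !mxE.
have -> : tcoef a i (Ny M).-1 m = tcoef a i j.+1 m by [].
have [jN|_] := eqVneq j.+1 (Ny M).-1.
  have -> : j.+2 = Ny M by have := ltn_ord j; lia.
  by have [->|_] := eqVneq (j : nat) 0%N => /=; ring.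
by have [->|_] := eqVneq (j : nat) 0%N => /=; ring.
Qed.

(** * Comparison of two sweeps *)

Section Comparison.
Variables Ut Ul : meshfun R.
Hypothesis HU : ordered_upper_lower P M Ut Ul.
Hypothesis c_ge0 : forall (a : 'I_2) (i j m : nat),
  level M m -> in_mesh M i j -> 0 <= c a i j m.
Hypothesis Hf : forall (m i j : nat) (a a' : 'I_2) (u : 'rV[R]_2),
  level M m -> in_mesh M i j -> a != a' ->
  mxle (vals Ul i j m) u -> mxle u (vals Ut i j m) ->
  df P a a (node i j m) u <= c a i j m /\
  0 <= - df P a a' (node i j m) u.

Lemma le_cmax a i j m : in_mesh M i j -> c a i j m <= cmax M c a m.
Proof.
move=> /andP[iN jN]; rewrite /cmax.
pose row (i' : 'I_(Nx M).+1) :=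
  \big[Num.max/c a 0%N 0%N m]_(j' < (Ny M).+1) c a i' j' m.
apply: (le_trans _ (le_bigmax _ row (Ordinal (iN : (i < (Nx M).+1)%N)))).
exact: (le_bigmax _ (fun j' : 'I_(Ny M).+1 => c a i j' m)
  (Ordinal (jN : (j < (Ny M).+1)%N))).
Qed.

Lemma cmax_ge0 a m : level M m -> 0 <= cmax M c a m.
Proof.
by move=> mL; apply: le_trans (le_cmax a m (isT : in_mesh M 0 0)); exact: c_ge0.
Qed.

(** Along the segment from [u] to [v] the derivative of [f_a] is
    [(v_a - u_a) d_a f_a + (v_b - u_b) d_b f_a] with [b <> a]: the first term is at
    most [c_a (v_a - u_a)], the second is nonpositive. *)
Lemma reaction_increment_le m i j a (u v : 'rV[R]_2) :
  level M m -> in_mesh M i j ->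
  mxle (vals Ul i j m) u -> mxle u v -> mxle v (vals Ut i j m) ->
  f P a (node i j m, v) - f P a (node i j m, u)
  <= cmax M c a m * (v 0 a - u 0 a).
Proof.
move=> mL ij ul uv vt.
have fdiff (x : 'rV[R]_2) :
    differentiable (fun w : 'rV[R]_2 => f P a (node i j m, w)) x.
  exact: (differentiable_smooth_slice (f_smooth HP a) (node_in_QT mL ij)).
apply: (segment_increment_le fdiff) => s /itvP s01.
set x := u + s *: (v - u).
have lx : mxle (vals Ul i j m) x.
  move=> k b; apply: le_trans (ul k b) _.
  by rewrite !mxE lerDl mulr_ge0 ?s01// subr_ge0.
have xt : mxle x (vals Ut i j m).
  move=> k b; apply: le_trans (vt k b).
  rewrite !mxE -lerBrDl ler_piMl ?s01// subr_ge0; exact: uv.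
have Df b : a != b -> df P a a (node i j m) x <= c a i j m /\
  0 <= - df P a b (node i j m) x by move=> ab; apply: Hf.
rewrite derive_rV// (bigD1 a)//= -[leRHS]addr0; apply: lerD.
  (* [lift a ord0] is the other component index. *)
  have [dfa _] := Df _ (neq_lift a ord0).
  rewrite !mxE mulrC ler_wpM2r ?subr_ge0//.
  exact: le_trans dfa (le_cmax _ _ ij).
apply: sumr_le0 => b ba; rewrite mulr_ge0_le0 ?mxE ?subr_ge0//.
by have [_] := Df b (negbT (etrans (eq_sym _ _) (negPf ba))); rewrite oppr_ge0.
Qed.

Definition level_of (U : meshfun R) m : 'I_2 -> nat -> block :=
  fun a i => block_of M U a i m.

Definition lines_le (V V' : 'I_2 -> nat -> block) : Prop :=
  forall a i, (i <= Nx M)%N -> mxle (V a i) (V' a i).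

Lemma lines_le_refl V : lines_le V V.
Proof. by move=> a i _. Qed.
#[local] Hint Resolve lines_le_refl : core.

Lemma lines_le_trans V1 V0 V2 :
  lines_le V0 V1 -> lines_le V1 V2 -> lines_le V0 V2.
Proof. by move=> V01 V12 a i iN; apply: mxle_trans (V01 a i iN) (V12 a i iN). Qed.

Lemma line_rhs_le a i m V V' Y Y' W W' :
  level M m -> (0 < i < Nx M)%N ->
  lines_le (level_of Ul m) V -> lines_le V V' -> lines_le V' (level_of Ut m) ->
  mxle Y Y' -> mxle W W' ->
  mxle (line_rhs a i m V Y W) (line_rhs a i m V' Y' W').
Proof.
move=> mL iN lV VV' V't YY' WW' j z; rewrite (ord1 z) {z}.
have [iN0 iN1] : (i <= Nx M /\ i.+1 <= Nx M)%N by lia.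
have ij := line_in_mesh j iN0.
rewrite /line_rhs /Lmx /Rmx !mul_diag_mx !mxE.
have rowle : mxle (\row_b V b i j 0) (\row_b V' b i j 0).
  by move=> k b; rewrite !mxE; exact: VV'.
have lrow : mxle (vals Ul i j.+1 m) (\row_b V b i j 0).
  by move=> k b; have := lV b i iN0 j 0; rewrite !mxE.
have rowt : mxle (\row_b V' b i j 0) (vals Ut i j.+1 m).
  by move=> k b; have := V't b i iN0 j 0; rewrite !mxE.
have := reaction_increment_le a mL ij lrow rowle rowt; rewrite !mxE.
have := ler_wpM2l (lcoef_ge0 a mL ij) (YY' j 0).
have := ler_wpM2l (rcoef_ge0 a i j.+1 m) (VV' a i.+1 iN1 j 0).
have tauV_ge0 : 0 <= tau^-1 by rewrite invr_ge0 ltW ?tau_gt0.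
have := ler_wpM2l tauV_ge0 (WW' j 0).
lra.
Qed.

Lemma line_lhs_le_inv a i m X X' :
  level M m -> (i <= Nx M)%N ->
  mxle (line_lhs a i m X) (line_lhs a i m X') -> mxle X X'.
Proof.
move=> mL iN XX'; suff : mxle 0 (X' - X).
  by move=> + j k => /(_ j k); rewrite !mxE subr_ge0.
apply: (@Zmatrix_ge0 _ _ (Amx P M a i m + (cmax M c a m)%:M)).
- move=> j k jk; rewrite mxE [X in _ + X]mxE (negPf jk) addr0.
  exact: Amx_offdiag_le0.
- move=> j; under eq_bigr do rewrite mxE.
  rewrite big_split ltr_wpDr//; last exact: Amx_rowsum_gt0.
  by apply: sumr_ge0 => k _; rewrite mxE mulrn_wge0// cmax_ge0.
- move=> j k; rewrite mulmxDl mul_scalar_mx mulmxBr scalerBr.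
  by have := XX' j k; rewrite /line_lhs !mxE; lra.
Qed.

(** [X] is a subsolution of the sweep with data [V], [Y], [W] and [X'] a
    supersolution with larger data. The lines [Y], [Y'] need only be ordered where
    [X], [X'] are, which lets Gauss-Seidel take [Y = X] and climb line by line. *)
Lemma sweep_le m V V' X X' Y Y' W W' :
  level M m ->
  lines_le (level_of Ul m) V -> lines_le V V' -> lines_le V' (level_of Ut m) ->
  (forall a i, (0 < i < Nx M)%N -> mxle (W a i) (W' a i)) ->
  (forall a i, (0 < i < Nx M)%N ->
    mxle (line_lhs a i m (X a i)) (line_rhs a i m V (Y a i.-1) (W a i))) ->
  (forall a i, (0 < i < Nx M)%N ->
    mxle (line_rhs a i m V' (Y' a i.-1) (W' a i)) (line_lhs a i m (X' a i))) ->
  (forall a i, (i < Nx M)%N -> mxle (X a i) (X' a i) -> mxle (Y a i) (Y' a i)) ->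
  (forall a i, i = 0%N \/ i = Nx M -> mxle (X a i) (X' a i)) ->
  lines_le X X'.
Proof.
move=> mL lV VV' V't WW' Xsub X'sup YY' bdry a; elim=> [|i IHi] iN.
  by apply: bdry; left.
have [iN1|iN1] : (i.+1 = Nx M) \/ (i.+1 < Nx M)%N by lia.
  by apply: bdry; right.
apply: (line_lhs_le_inv mL iN).
apply: mxle_trans (Xsub a i.+1 iN1) (mxle_trans _ (X'sup a i.+1 iN1)).
by apply: line_rhs_le => //=; [apply: YY' => //; apply: IHi; lia | exact: WW'].
Qed.

(** * Monotonicity of the upper and lower sequences *)

Lemma oul_supersolution a i m W :
  level M m -> (0 < i < Nx M)%N -> mxle W (block_of M Ut a i m.-1) ->
  mxle (line_rhs a i m (level_of Ut m) (level_of Ut m a i.-1) W)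
       (line_lhs a i m (level_of Ut m a i)).
Proof.
move=> mL iN WU j z; rewrite (ord1 z) -subr_ge0 line_defectE {z}.
have Nj := ltn_ord j; have ij := line_in_mesh j (ltnW (proj2 (andP iN))).
have b0 : boundary_node M i 0 by rewrite /boundary_node/in_mesh/interior_node; lia.
have bN : boundary_node M i (Ny M).
  by rewrite /boundary_node/in_mesh/interior_node; lia.
have /andP[_ g0] := oul_bdry HU a mL b0.
have /andP[_ gN] := oul_bdry HU a mL bN.
apply: addr_ge0; last first.
  by case: ifP => // _; rewrite mulr_ge0 ?tcoef_ge0 ?subr_ge0.
apply: addr_ge0; last first.
  by case: ifP => // _; rewrite mulr_ge0 ?bcoef_ge0 ?subr_ge0.
apply: addr_ge0; first exact: (oul_upper HU a mL (interior_line_node j iN)).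
rewrite mulr_ge0 ?invr_ge0 ?(ltW tau_gt0)// subr_ge0.
by have := WU j 0; rewrite mxE.
Qed.

Lemma oul_subsolution a i m W :
  level M m -> (0 < i < Nx M)%N -> mxle (block_of M Ul a i m.-1) W ->
  mxle (line_lhs a i m (level_of Ul m a i))
       (line_rhs a i m (level_of Ul m) (level_of Ul m a i.-1) W).
Proof.
move=> mL iN UW j z; rewrite (ord1 z) -subr_le0 line_defectE {z}.
have Nj := ltn_ord j; have ij := line_in_mesh j (ltnW (proj2 (andP iN))).
have b0 : boundary_node M i 0 by rewrite /boundary_node/in_mesh/interior_node; lia.
have bN : boundary_node M i (Ny M).
  by rewrite /boundary_node/in_mesh/interior_node; lia.
have /andP[g0 _] := oul_bdry HU a mL b0.
have /andP[gN _] := oul_bdry HU a mL bN.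
rewrite -[leRHS]addr0; apply: lerD; last first.
  by case: ifP => // _; rewrite mulr_ge0_le0 ?tcoef_ge0 ?subr_le0.
rewrite -[leRHS]addr0; apply: lerD; last first.
  by case: ifP => // _; rewrite mulr_ge0_le0 ?bcoef_ge0 ?subr_le0.
rewrite -[leRHS]addr0; apply: lerD.
  exact: (oul_lower HU a mL (interior_line_node j iN)).
rewrite mulr_ge0_le0 ?invr_ge0 ?(ltW tau_gt0)// subr_le0.
by have := UW j 0; rewrite mxE.
Qed.

Lemma gblock_between a i m :
  level M m -> i = 0%N \/ i = Nx M ->
  mxle (level_of Ul m a i) (gblock P M a i m) /\
  mxle (gblock P M a i m) (level_of Ut m a i).
Proof.
move=> mL iB.
suff gE (j : 'I_(Ny M).-1) :
    Ul a i j.+1 m <= g P a (node i j.+1 m) <= Ut a i j.+1 m.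
  by split=> j k; rewrite !mxE; have /andP[] := gE j.
apply: (oul_bdry HU) => //; have := ltn_ord j.
by rewrite /boundary_node/in_mesh/interior_node; case: iB => ->; lia.
Qed.

Lemma psiblock_between a i :
  (i <= Nx M)%N ->
  mxle (level_of Ul 0 a i) (psiblock P M a i) /\
  mxle (psiblock P M a i) (level_of Ut 0 a i).
Proof.
by move=> iN; split=> j k; rewrite !mxE;
  have /andP[] := oul_init HU a (line_in_mesh j iN).
Qed.

Variable nm : nat -> nat.

Lemma block_sequence_start eta U0 U m :
  block_sequence P eta c nm U0 U -> level M m ->
  lines_le (level_of U0 m) (U m 0%N) /\ lines_le (U m 0%N) (level_of U0 m).
Proof. by move=> US mL; split=> a i iN; rewrite (bs_start US). Qed.

Lemma swept_le eta (U U' : iterates R M) m n a i :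
  (i <= Nx M)%N -> lines_le (U m n) (U' m n) ->
  mxle (U m n.+1 a i) (U' m n.+1 a i) ->
  mxle (swept eta U m n a i) (swept eta U' m n a i).
Proof. by rewrite /swept; case: eta => // iN UU' _; apply: UU'. Qed.

Section SameMethod.
Variables (eta : bool) (L U : iterates R M).
Hypotheses (HL : block_sequence P eta c nm Ul L)
  (HUseq : block_sequence P eta c nm Ut U).

Definition bracket m n : Prop :=
  [/\ lines_le (level_of Ul m) (L m n), lines_le (L m n) (U m n)
    & lines_le (U m n) (level_of Ut m)].

Definition monotone_step m n : Prop :=
  lines_le (L m n) (L m n.+1) /\ lines_le (U m n.+1) (U m n).

(** The two sequences need each other: comparing consecutive sweeps of one of
    them requires its iterates to stay between [Ul] and [Ut], and on the inner
    side this bound comes from the order with the other sequence. *)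
Lemma bracket_level m :
  level M m ->
  (forall a i, (0 < i < Nx M)%N ->
    [/\ mxle (level_of Ul m.-1 a i) (Defs.approx P nm L m.-1 a i),
        mxle (Defs.approx P nm L m.-1 a i) (Defs.approx P nm U m.-1 a i) &
        mxle (Defs.approx P nm U m.-1 a i) (level_of Ut m.-1 a i)]) ->
  forall n, bracket m n /\ monotone_step m n.
Proof.
move=> mL prev.
have [lL0 L0l] := block_sequence_start HL mL.
have [tU0 U0t] := block_sequence_start HUseq mL.
have lt : lines_le (level_of Ul m) (level_of Ut m).
  move=> a i iN j k; rewrite !mxE; apply: (oul_le HU) => //.
  exact: (line_in_mesh j iN).
have stepL := fun n a i => @block_sequence_step _ _ _ _ m n a i HL mL.
have stepU := fun n a i => @block_sequence_step _ _ _ _ m n a i HUseq mL.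
have bdryL := fun n a i => @block_sequence_bdry _ _ _ _ m n a i HL mL.
have bdryU := fun n a i => @block_sequence_bdry _ _ _ _ m n a i HUseq mL.
pose pL a i := Defs.approx P nm L m.-1 a i.
pose pU a i := Defs.approx P nm U m.-1 a i.
elim=> [|n [[lL LU Ut'] [Linc Udec]]].
  (* For the first sweep, the other term of the comparison is [Ul] or [Ut]. *)
  have L0t := lines_le_trans L0l lt.
  have lU0 := lines_le_trans lt tU0.
  do !split=> //; first exact: lines_le_trans L0l lU0.
  - apply: (lines_le_trans L0l).
    apply: (@sweep_le m (level_of Ul m) (L m 0%N) _ _ (level_of Ul m)
      (swept eta L m 0) pL pL mL) => // a i iN.
    + by apply: oul_subsolution => //; have [] := prev a i iN.
    + by rewrite stepL.
    + by rewrite /swept; case: (eta) => // _; apply: lL0; exact: ltnW.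
    + by move/(gblock_between a mL): (iN) => []; rewrite bdryL.
  - apply: (lines_le_trans _ tU0).
    apply: (@sweep_le m (U m 0%N) (level_of Ut m) _ _ (swept eta U m 0)
      (level_of Ut m) pU pU mL) => // a i iN.
    + by rewrite stepU.
    + by apply: oul_supersolution => //; have [] := prev a i iN.
    + by rewrite /swept; case: (eta) => // _; apply: U0t; exact: ltnW.
    + by move/(gblock_between a mL): (iN) => []; rewrite bdryU.
have LU1 : lines_le (L m n.+1) (U m n.+1).
  apply: (@sweep_le m (L m n) (U m n) _ _ (swept eta L m n) (swept eta U m n)
    pL pU mL) => // a i iN.
  - by have [] := prev a i iN.
  - by rewrite stepL.
  - by rewrite stepU.
  - by apply: swept_le LU; exact: ltnW.
  - by rewrite bdryL// bdryU.
have lL1 := lines_le_trans lL Linc.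
have Ut1 := lines_le_trans Udec Ut'.
do !split=> //.
- apply: (@sweep_le m (L m n) (L m n.+1) _ _ (swept eta L m n)
    (swept eta L m n.+1) pL pL mL) => //; last 4 first.
  + by move=> a i iN; rewrite stepL.
  + by move=> a i iN; rewrite stepL.
  + by move=> a i iN; rewrite /swept; case: (eta) => // _; apply: Linc; exact: ltnW.
  + by move=> a i iN; rewrite !bdryL.
  exact: lines_le_trans LU1 Ut1.
- apply: (@sweep_le m (U m n.+1) (U m n) _ _ (swept eta U m n.+1)
    (swept eta U m n) pU pU mL) => //; last 4 first.
  + by move=> a i iN; rewrite stepU.
  + by move=> a i iN; rewrite stepU.
  + by move=> a i iN; rewrite /swept; case: (eta) => // _; apply: Udec; exact: ltnW.
  + by move=> a i iN; rewrite !bdryU.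
  exact: lines_le_trans lL1 LU1.
Qed.

Lemma bracket_all_levels m n : level M m -> bracket m n /\ monotone_step m n.
Proof.
elim: m n => [|m IHm] n mL; first by [].
apply: bracket_level => // a i iN; have iN' : (i <= Nx M)%N by lia.
case: m IHm mL => [|m] IHm mL /=.
  by have [] := psiblock_between a iN'; split.
have mL' : level M m.+1 by rewrite /level in mL *; lia.
have [[lL LU Ut'] _] := IHm (nm m.+1) mL'.
by split; [apply: lL | apply: LU | apply: Ut'].
Qed.

End SameMethod.

(** * Jacobi against Gauss-Seidel *)

(** Two methods with the same starting values; the hypothesis on [swept] says that
    the left-neighbour lines they use are ordered as soon as the iterates are. *)
Lemma methods_ordered eta eta' U0 (S S' : iterates R M) :
  block_sequence P eta c nm U0 S -> block_sequence P eta' c nm U0 S' ->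
  (forall m n, level M m -> lines_le (level_of Ul m) (S m n)) ->
  (forall m n, level M m -> lines_le (S' m n) (level_of Ut m)) ->
  (forall m n a i, level M m -> (i <= Nx M)%N ->
    lines_le (S m n) (S' m n) -> mxle (S m n.+1 a i) (S' m n.+1 a i) ->
    mxle (swept eta S m n a i) (swept eta' S' m n a i)) ->
  forall m n, level M m -> lines_le (S m n) (S' m n).
Proof.
move=> HS HS' lS S't swept_SS'; elim=> [//|m IHm] n mL.
have prev a i : (0 < i < Nx M)%N ->
    mxle (Defs.approx P nm S m a i) (Defs.approx P nm S' m a i).
  move=> iN; case: m IHm mL => [//|m] IHm mL /=.
  by apply: IHm; [rewrite /level in mL *|]; lia.
elim: n => [|n IHn].
  have [_ S0] := block_sequence_start HS mL.
  by have [S0' _] := block_sequence_start HS' mL; exact: lines_le_trans S0 S0'.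
apply: (@sweep_le m.+1 (S m.+1 n) (S' m.+1 n) _ _ (swept eta S m.+1 n)
  (swept eta' S' m.+1 n) (Defs.approx P nm S m) (Defs.approx P nm S' m) mL) => //.
- exact: lS.
- exact: S't.
- by move=> a i iN; rewrite (block_sequence_step n a HS).
- by move=> a i iN; rewrite (block_sequence_step n a HS').
- by move=> a i iN; apply: swept_SS' => //; exact: ltnW.
- move=> a i iN.
  by rewrite (block_sequence_bdry n a HS)// (block_sequence_bdry n a HS').
Qed.

End Comparison.
End Mesh.

Theorem theorem9 (R : realType) (P : problem R) (M : mesh)
  (HP : standing_assumptions P)
  (Ut Ul : meshfun R) (HU : ordered_upper_lower P M Ut Ul)
  (c : meshfun R)
  (c_ge0 : forall (a : 'I_2) (i j m : nat),
     level M m -> in_mesh M i j -> 0 <= c a i j m)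
  (c_bounded : exists K : R, forall (a : 'I_2) (i j m : nat),
     level M m -> in_mesh M i j -> c a i j m <= K)
  (Hf : forall (m i j : nat) (a a' : 'I_2) (u : 'rV[R]_2),
     level M m -> in_mesh M i j -> a != a' ->
     mxle (vals Ul i j m) u -> mxle u (vals Ut i j m) ->
     df P a a (node P M i j m) u <= c a i j m /\
     0 <= - df P a a' (node P M i j m) u)
  (nm : nat -> nat)
  (nm_ge1 : forall m : nat, level M m -> (1 <= nm m)%N)
  (UJ LJ UGS LGS : iterates R M)
  (HUJ : block_Jacobi P c nm Ut UJ)
  (HLJ : block_Jacobi P c nm Ul LJ)
  (HUGS : block_Gauss_Seidel P c nm Ut UGS)
  (HLGS : block_Gauss_Seidel P c nm Ul LGS) :
  forall (n m i : nat) (a : 'I_2), level M m -> (i <= Nx M)%N ->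
    [/\ mxle (LJ m n a i) (LGS m n a i),
        mxle (LGS m n a i) (UGS m n a i) &
        mxle (UGS m n a i) (UJ m n a i)].
Proof.
have bracketJ := bracket_all_levels HP HU c_ge0 Hf HLJ HUJ.
have bracketGS := bracket_all_levels HP HU c_ge0 Hf HLGS HUGS.
have lowerJ_GS m n : level M m -> lines_le (LJ m n) (LGS m n).
  apply: (methods_ordered HP c_ge0 Hf HLJ HLGS) => {}m {}n.
  - by move=> mL; have [[]] := bracketJ m n mL.
  - move=> mL; have [[_ LU Ut'] _] := bracketGS m n mL.
    exact: lines_le_trans LU Ut'.
  (* Old Jacobi line <= old Gauss-Seidel line <= new Gauss-Seidel line. *)
  - move=> a i mL iN LL' _; have [_ [Linc _]] := bracketGS m n mL.
    exact: mxle_trans (LL' a i iN) (Linc a i iN).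
have upperGS_J m n : level M m -> lines_le (UGS m n) (UJ m n).
  apply: (methods_ordered HP c_ge0 Hf HUGS HUJ) => {}m {}n.
  - move=> mL; have [[lL LU _] _] := bracketGS m n mL.
    exact: lines_le_trans lL LU.
  - by move=> mL; have [[]] := bracketJ m n mL.
  (* New Gauss-Seidel line <= old Gauss-Seidel line <= old Jacobi line. *)
  - move=> a i mL iN UU' _; have [_ [_ Udec]] := bracketGS m n mL.
    exact: mxle_trans (Udec a i iN) (UU' a i iN).
move=> n m i a mL iN; have [[_ LU _] _] := bracketGS m n mL.
by split; [apply: lowerJ_GS | apply: LU | apply: upperGS_J].
Qed.
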